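(* For every integer $d\ge 1$ there is a tree $T$ such that if $G$ is a $d$-degenerate graph, then $G$ is not Ramsey for $T$; that is, there is a $2$-colouring of the edges of $G$ with no monochromatic copy of $T$.
   Context: Graphs (and trees) are finite and simple. For an integer $d$, a graph $G$ is $d$-degenerate if every subgraph of $G$ has minimum degree at most $d$. A graph $G$ is Ramsey for a graph $H$ if every $2$-colouring of the edges of $G$ contains a monochromatic copy of $H$ (as a not necessarily induced subgraph). *)

(* Defs.v *)
From mathcomp Require Import all_boot.

Set Implicit Arguments.
Unset Strict Implicit.
Unset Printing Implicit Defensive.

Record sgraph := SGraph {
  vertex :> finType;
  adj : rel vertex;
  adj_sym : symmetric adj;
  adj_irrefl : irreflexive adj
}.

Definition degree (G : sgraph) (x : G) : nat := #|[set y | adj x y]|.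

(* Every degree is smaller than #|G|, so the default value #|G| never affects
   the minimum of a nonempty graph; the null graph gets minimum degree 0. *)
Definition min_degree (G : sgraph) : nat :=
  \big[minn/#|G|]_(x : G) degree x.

(* f exhibits a (not necessarily induced) copy of H in G. *)
Definition is_copy (H G : sgraph) (f : H -> G) : Prop :=
  injective f /\ forall x y : H, adj x y -> adj (f x) (f y).

(* Up to isomorphism, the subgraphs of G are the graphs with a copy in G. *)
Definition subgraph (H G : sgraph) : Prop := exists f : H -> G, is_copy f.

Definition degenerate (d : nat) (G : sgraph) : Prop :=
  forall H : sgraph, subgraph H G -> min_degree H <= d.

Definition connected (G : sgraph) : Prop :=
  0 < #|G| /\ forall x y : G, connect (@adj G) x y.

(* Size at least 3 excludes walking back and forth along a single edge. *)
Definition acyclic (G : sgraph) : Prop :=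
  forall p : seq G, 2 < size p -> ~ ucycle (@adj G) p.

Definition tree (G : sgraph) : Prop := connected G /\ acyclic G.

(* An edge xy is the pair [set x; y]; the values of a colouring on sets that
   are not edges are irrelevant. *)
Definition colouring (G : sgraph) : Type := {set G} -> bool.

Definition mono_copy (H G : sgraph) (c : colouring G) : Prop :=
  exists (f : H -> G) (b : bool),
    is_copy f /\ forall x y : H, adj x y -> c [set f x; f y] = b.

Definition ramsey (G H : sgraph) : Prop :=
  forall c : colouring G, mono_copy H c.

(* Main.v *)
(** Order the vertices of a [d]-degenerate graph so that each has at most [d]
    earlier neighbours, and let [l] be a greedy proper colouring with labels
    [0..d].  Colour an edge by whether [l] increases or decreases along it when
    it is traversed from its earlier to its later end: [l] is then strictly
    monotone along every monochromatic forward path, so such a path has at most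
    [d] edges.  In a copy of the complete [(d+1)]-ary tree of depth [d+1] each
    inner vertex has a child that comes later in the order, hence the copy
    contains a forward path with [d+1] edges and is not monochromatic. *)

Require Import Defs.
From mathcomp Require Import all_boot zify.

Set Implicit Arguments.
Unset Strict Implicit.
Unset Printing Implicit Defensive.

(** * Vertices of low degree in degenerate graphs *)

Lemma degree_lt (G : sgraph) (x : G) : degree x < #|G|.
Proof.
rewrite /degree -cardsT; apply: proper_card; rewrite properE subsetT /=.
by apply/subsetPn; exists x; rewrite !inE ?adj_irrefl.
Qed.

Lemma exists_min_degree (G : sgraph) :
  0 < #|G| -> exists x : G, degree x <= min_degree G.
Proof.
case/card_gt0P=> x0 _.
(* [minn] returns one of its arguments, so the minimum is a degree or the default [#|G|]; against
   the default any vertex will do. *)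
have : min_degree G = #|G| \/ exists x : G, min_degree G = degree x.
  apply: (big_ind (fun m => m = #|G| \/ exists x : G, m = degree x)).
  - by left.
  - by move=> m n Hm Hn; rewrite /minn; case: ifP.
  - by move=> x _; right; exists x.
case=> [E | [x E]]; last by exists x; rewrite E.
by exists x0; rewrite E ltnW ?degree_lt.
Qed.

Section Induced.
Variables (G : sgraph) (A : {set G}).

Definition induced_adj : rel {x | x \in A} := fun x y => adj (val x) (val y).

Lemma induced_sym : symmetric induced_adj.
Proof. by move=> x y; apply: adj_sym. Qed.

Lemma induced_irrefl : irreflexive induced_adj.
Proof. by move=> x; apply: adj_irrefl. Qed.

Definition induced : sgraph := SGraph induced_sym induced_irrefl.

Lemma induced_subgraph : subgraph induced G.
Proof. by exists val; split; [apply: val_inj | ]. Qed.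

Lemma induced_degree (x : induced) :
  degree x = #|[set y in A | adj (val x) y]|.
Proof.
rewrite /degree -(card_imset _ val_inj); apply: eq_card => y.
apply/imsetP/idP => [[z] | ]; rewrite !inE.
  by move=> xz ->; rewrite (valP z).
by case/andP=> Ay xy; exists (Sub y Ay); rewrite ?inE // /induced_adj /=.
Qed.

End Induced.

(** Degeneracy is applied to the subgraph induced on [A]. *)
Lemma degenerate_low_degree (d : nat) (G : sgraph) (A : {set G}) :
  degenerate d G -> 0 < #|A| ->
  exists2 x, x \in A & #|[set y in A | adj x y]| <= d.
Proof.
move=> dG A0; have cA : 0 < #|induced A| by rewrite card_sig.
have [x lex] := exists_min_degree cA.
exists (val x); first exact: valP.
rewrite -induced_degree; exact: leq_trans lex (dG _ (induced_subgraph A)).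
Qed.

(** * Greedy ordering and labelling, and the edge colouring they define *)

Lemma free_label (T : finType) (d : nat) (B : {set T}) (l : T -> 'I_d.+1) :
  #|B| <= d -> exists i, forall y, y \in B -> l y != i.
Proof.
move=> leB; have : ~~ ([set: 'I_d.+1] \subset l @: B).
  apply/negP=> /subset_leq_card; rewrite cardsT card_ord => h.
  by have := leq_trans h (leq_trans (leq_imset_card l B) leB); rewrite ltnn.
case/subsetPn=> i _ /negP nBi; exists i => y By.
by apply/negP=> /eqP e; apply: nBi; rewrite -e; apply: imset_f.
Qed.

(** Induction on [#|A|]: a vertex [x] with at most [d] neighbours in [A] is put last and takes a
    label that none of them has. The bound on [r] leaves a rank for [x] above all others. *)
Lemma degenerate_order_labelling (d : nat) (G : sgraph) (A : {set G}) :
  degenerate d G ->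
  exists (r : G -> nat) (l : G -> 'I_d.+1),
    [/\ {in A, forall x, r x < #|A|},
        {in A &, forall x y, adj x y -> r x != r y},
        {in A &, forall x y, adj x y -> l x != l y} &
        {in A, forall x, #|[set y in A | adj x y && (r y < r x)]| <= d}].
Proof.
move=> dG; have [n cA] := ubnP #|A|; elim: n A cA => // n IHn A cA.
have [A0 | A0] := posnP #|A|.
  exists (fun=> 0), (fun=> ord0).
  by split=> x; rewrite (cards0_eq A0) inE.
have [x Ax degx] := degenerate_low_degree dG A0.
have cAx : #|A| = #|A :\ x|.+1 by rewrite (cardsD1 x A) Ax.
have [|r [l [rlt radj ladj rdeg]]] := IHn (A :\ x); first by lia.
have [i li] := free_label l degx.
pose r' y := if y == x then #|A :\ x| else r y.
pose l' y := if y == x then i else l y.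
have AxP y : y \in A -> (y == x) = false -> y \in A :\ x.
  by rewrite !inE => -> ->.
exists r', l'; split.
- move=> y Ay; rewrite /r' cAx; case: eqP => // /eqP/negbTE yx.
  by apply: leqW; apply: rlt; apply: AxP.
- move=> y z Ay Az yz; rewrite /r'.
  case: (y =P x) yz => [-> | /eqP/negbTE yx];
    case: (z =P x) => [-> | /eqP/negbTE zx] yz.
  + by rewrite adj_irrefl in yz.
  + by rewrite gtn_eqF // rlt // AxP.
  + by rewrite ltn_eqF // rlt // AxP.
  + by apply: radj => //; apply: AxP.
- move=> y z Ay Az yz; rewrite /l'.
  case: (y =P x) yz => [-> | /eqP/negbTE yx];
    case: (z =P x) => [-> | /eqP/negbTE zx] yz.
  + by rewrite adj_irrefl in yz.
  + by rewrite eq_sym li // inE Az.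
  + by rewrite li // inE Ay adj_sym.
  + by apply: ladj => //; apply: AxP.
- move=> y Ay; case: (y =P x) => [-> | /eqP/negbTE yx].
    apply: leq_trans degx; apply: subset_leq_card; apply/subsetP=> z.
    by rewrite !inE => /and3P[-> ->].
  apply: leq_trans (rdeg y (AxP _ Ay yx)); apply: subset_leq_card.
  apply/subsetP=> z; rewrite !inE /r' yx => /and3P[Az yz].
  (* Since [x] has the top rank, it is not an earlier neighbour of [y]. *)
  case: eqP => [_ | _ ->]; last by rewrite Az yz.
  by have := rlt y (AxP _ Ay yx); lia.
Qed.

(** Edges are unordered pairs, so [r] has to recover the direction of the edge. *)
Definition order_colouring {G : sgraph} (r l : G -> nat) : colouring G :=
  fun e => [exists x in e, exists y in e, (r x < r y) && (l x < l y)].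

Lemma order_colouringE (G : sgraph) (r l : G -> nat) (x y : G) :
  r x < r y -> order_colouring r l [set x; y] = (l x < l y).
Proof.
move=> rxy; apply/existsP/idP => [[u /andP[]] | lxy].
  rewrite !inE => /orP[]/eqP-> /existsP[v /andP[]];
    by rewrite !inE => /orP[]/eqP->; lia.
exists x; rewrite set21; apply/existsP; exists y.
by rewrite set22 rxy lxy.
Qed.

(** * Complete trees of bounded depth *)

Section CompleteTree.

(* A node is the word of child indices read from the node up to the root, so
   that the parent is obtained by dropping the head. *)
Variables (h k : nat).
Local Notation node := {bseq h of 'I_k}.

Lemma size_parent (s : node) : size (behead s) <= h.
Proof. by rewrite size_behead (leq_trans (leq_pred _)) ?size_bseq. Qed.

Definition parent (s : node) : node := Bseq (size_parent s).

(** The root is its own [parent], so loops are excluded explicitly. *)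
Definition tree_adj : rel node :=
  fun s t => (s != t) && ((parent s == t) || (parent t == s)).

Lemma tree_adj_sym : symmetric tree_adj.
Proof. by move=> s t; rewrite /tree_adj eq_sym orbC. Qed.

Lemma tree_adj_irrefl : irreflexive tree_adj.
Proof. by move=> s; rewrite /tree_adj eqxx. Qed.

Definition complete_tree : sgraph := SGraph tree_adj_sym tree_adj_irrefl.

(** A node is one letter longer than its parent unless both are the root, which [s != t] rules
    out. *)
Lemma tree_adj_parent (s t : node) :
  tree_adj s t -> size t <= size s -> t = parent s.
Proof.
case/andP=> st /orP[/eqP-> // | /eqP pt] ts.
move: st; rewrite -pt -val_eqE /= size_behead in ts *.
by case: (val t) ts => [| a w] //=; rewrite ltnn.
Qed.

Lemma complete_tree_connected : connected complete_tree.
Proof.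
have cs : connect_sym tree_adj by apply: sym_connect_sym; exact: tree_adj_sym.
have to_root (s : node) : connect tree_adj s [bseq].
  have [n] := ubnP (size s); elim: n s => // n IHn s ltn.
  have [/nilP s0 | s0] := boolP (nilp s).
    by rewrite (_ : s = [bseq]) ?connect0 //; apply/val_inj.
  rewrite /nilp -lt0n in s0.
  apply: connect_trans (connect1 _) (IHn (parent s) _); last first.
    by rewrite /= size_behead; lia.
  rewrite /tree_adj eqxx andbT -val_eqE /=.
  case: (bseqval s) s0 => //= a w _.
  by apply/eqP=> /(congr1 size) /=; lia.
split; first by apply/card_gt0P; exists [bseq].
move=> s t; apply: connect_trans (to_root s) _.
by rewrite [connect _ _ _]cs to_root.
Qed.

(* Both cycle neighbours of a deepest vertex would be its parent. *)
Lemma complete_tree_acyclic : acyclic complete_tree.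
Proof.
move=> p; case: p => // s0 p0; set p := s0 :: p0 => szp cyc.
have ps0 : s0 \in p by rewrite mem_head.
case: (@arg_maxnP _ s0 (fun s => s \in p) (fun s : node => size s) ps0) => s ps smax.
have [i q Eq] := rot_to ps.
have {cyc}: ucycle tree_adj (s :: q).
  by move: cyc; rewrite /ucycle -Eq rot_cycle rot_uniq.
have {smax} qmax (t : node) : t \in q -> size t <= size s.
  by move=> qt; apply: smax; rewrite -(mem_rot i) Eq inE qt orbT.
have {szp} : 1 < size q by rewrite -ltnS -[(size q).+1]/(size (s :: q)) -Eq size_rot.
(* The cycle neighbours of [s] are the two ends [t] and [u] of the rest, distinct because the cycle
   has at least three vertices. *)
case: q {Eq} qmax => // t q; case/lastP: q => // q u qmax _.
rewrite /ucycle /= rcons_path last_rcons => /andP[/andP[st /andP[_ us]]].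
case/and3P=> _ + _; rewrite mem_rcons inE negb_or => /andP[/eqP[]].
rewrite (tree_adj_parent st) ?qmax ?mem_head //.
rewrite tree_adj_sym in us; rewrite (tree_adj_parent us) //.
by apply: qmax; rewrite inE mem_rcons mem_head orbT.
Qed.

Lemma complete_tree_tree : tree complete_tree.
Proof. by split; [exact: complete_tree_connected | exact: complete_tree_acyclic]. Qed.

Lemma complete_tree_children (s : complete_tree) : size (s : node) < h ->
  exists2 ch : 'I_k -> complete_tree, injective ch &
    forall i, adj s (ch i) /\ size (ch i : node) = (size (s : node)).+1.
Proof.
move=> ltsh; exists (fun i => Bseq (ltsh : size (i :: (s : node)) <= h)).
  by move=> i j /(congr1 val) [].
move=> i; split=> //=; rewrite /tree_adj; apply/andP; split.
  by rewrite -val_eqE /=; apply/eqP=> /(congr1 size) /=; lia.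
by apply/orP; right; rewrite -val_eqE /=.
Qed.

End CompleteTree.

(** * Absence of monochromatic copies *)

Lemma complete_tree_not_mono (d : nat) (G : sgraph) (r : G -> nat)
    (l : G -> 'I_d.+1) :
  (forall x y, adj x y -> r x != r y) ->
  (forall x y, adj x y -> l x != l y) ->
  (forall x, #|[set y | adj x y && (r y < r x)]| <= d) ->
  ~ mono_copy (complete_tree d.+1 d.+1) (order_colouring r l).
Proof.
move=> radj ladj rdeg [f [b [[finj fadj] fmono]]].
(* Reversing the labels when [b] is false makes [g] rise along forward edges of the copy in either
   colour. *)
pose g x := if b then l x : nat else d - l x.
(* At depth [d.+1] this is absurd, as [g] never exceeds [d]. *)
suff /(_ _ (leqnn _)) [s _]: forall n, n <= d.+1 ->
    exists2 s : complete_tree d.+1 d.+1,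
      size (s : {bseq d.+1 of 'I_d.+1}) = n & n <= g (f s).
  by rewrite /g; have := ltn_ord (l (f s)); case: b {g fmono}; lia.
elim=> [_ | n IHn ltnd]; first by exists [bseq].
have [s szs gs] := IHn (ltnW ltnd).
have [|ch chinj chP] := @complete_tree_children d.+1 d.+1 s; first by rewrite szs.
(* Otherwise the [d.+1] children would be sent injectively to earlier neighbours of [f s]. *)
have [i ri] : exists i, r (f s) < r (f (ch i)).
  apply/existsP; apply: contraT; rewrite negb_exists => /forallP nlt.
  have : #|[set f (ch i) | i : 'I_d.+1]| <= d.
    apply: leq_trans (rdeg (f s)); apply: subset_leq_card.
    apply/subsetP=> _ /imsetP[i _ ->]; rewrite inE.
    have si := fadj _ _ (chP i).1; rewrite si /= ltn_neqAle eq_sym radj //.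
    by rewrite leqNgt nlt.
  by rewrite card_imset ?card_ord ?ltnn // => i j /finj/chinj.
have [si szi] := chP i; exists (ch i); first by rewrite szi szs.
have := fmono _ _ si; rewrite (order_colouringE _ ri).
(* When [b] is false the colour gives only a weak decrease of [l]; properness makes it strict. *)
have := ladj _ _ (fadj _ _ si); rewrite -val_eqE /=.
have := ltn_ord (l (f s)); have := ltn_ord (l (f (ch i))).
by move: gs; rewrite {IHn}/g; case: b {fmono}; lia.
Qed.

Theorem theorem1p3 (d : nat) (hd : 1 <= d) :
  exists T : sgraph, tree T /\
    forall G : sgraph, degenerate d G ->
      ~ ramsey G T /\ exists c : colouring G, ~ mono_copy T c.
Proof.
exists (complete_tree d.+1 d.+1); split; first exact: complete_tree_tree.
move=> G dG.
have [r [l [_ radj ladj rdeg]]] := @degenerate_order_labelling d G [set: G] dG.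
have nomono : ~ mono_copy (complete_tree d.+1 d.+1) (order_colouring r l).
  apply: complete_tree_not_mono => [x y | x y | x].
  - by apply: radj; rewrite in_setT.
  - by apply: ladj; rewrite in_setT.
  - have := rdeg x (in_setT x); congr (_ <= d); apply: eq_card => y.
    by rewrite !inE.
by split; [move/(_ (order_colouring r l)) | exists (order_colouring r l)].
Qed.
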